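(* Let $\mathbb{K}$ be an algebraic number field, let $d \geq 1$, and let $a_1,\dots,a_d$ be $C^2$-finite sequences over $\mathbb{K}$ of maximal order $r$ (i.e. each $a_s$ satisfies a $C^2$-finite recurrence of order at most $r$). Let $b$ be the interlacing of $a_1,\dots,a_d$, i.e. the sequence such that for $n = qd+s$ with $q\in\mathbb{N}$ and $0\le s<d$ one has $b(n)=a_{s+1}(q)$. Then $b$ satisfies a $C^2$-finite recurrence over $\mathbb{K}$ of order at most $dr$, and such a recurrence can be computed from given recurrences of $a_1,\dots,a_d$.
   Context: $\mathbb{N}=\{0,1,2,\dots\}$. A sequence $c\in\mathbb{K}^{\mathbb{N}}$ is called $C$-finite over $\mathbb{K}$ if there are constants $\gamma_0,\dots,\gamma_t\in\mathbb{K}$, $\gamma_t\neq 0$, with $\gamma_0c(n)+\dots+\gamma_tc(n+t)=0$ for all $n\in\mathbb{N}$. A $C^2$-finite recurrence over $\mathbb{K}$ of order $r$ for a sequence $a\in\mathbb{K}^{\mathbb{N}}$ is a relation $c_0(n)a(n)+\dots+c_r(n)a(n+r)=0$ valid for all $n\in\mathbb{N}$, where $c_0,\dots,c_r$ are $C$-finite sequences over $\mathbb{K}$ and there is $n_0\in\mathbb{N}$ with $c_r(n)\neq 0$ for all $n\ge n_0$. A sequence is $C^2$-finite over $\mathbb{K}$ if it satisfies such a recurrence for some $r$. *)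

(* Defs.v *)
From mathcomp Require Import all_boot all_order all_algebra all_field.
Set Implicit Arguments.
Unset Strict Implicit.
Unset Printing Implicit Defensive.
Import GRing.Theory.
Local Open Scope ring_scope.

Section C2Finite.
Variable K : fieldType.
Implicit Types a b c : nat -> K.

Definition cfinite_rec (t : nat) (g : nat -> K) c : Prop :=
  g t != 0 /\ forall n : nat, \sum_(i < t.+1) g i * c (n + i)%N = 0.

Definition cfinite c : Prop := exists t g, cfinite_rec t g c.

Definition c2_recurrence (r : nat) (c : 'I_r.+1 -> nat -> K) a : Prop :=
  [/\ forall i : 'I_r.+1, cfinite (c i),
      exists n0 : nat, forall n : nat, (n0 <= n)%N -> c ord_max n != 0
    & forall n : nat, \sum_(i < r.+1) c i n * a (n + i)%N = 0].

Definition c2_finite_of_order_le (r : nat) a : Prop :=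
  exists (m : nat) (c : 'I_m.+1 -> nat -> K), (m <= r)%N /\ c2_recurrence c a.

Definition interlacing (d : nat) (a : 'I_d -> nat -> K) b : Prop :=
  forall (q : nat) (s : 'I_d), b (q * d + s)%N = a s q.

End C2Finite.

(* Finite data over which algorithms operate: natural numbers, pairs, lists. *)
Inductive dtype : Type :=
  | Nat
  | Pair of dtype & dtype
  | List of dtype.

Fixpoint data (A : dtype) : Type :=
  match A with
  | Nat => nat
  | Pair A B => (data A * data B)%type
  | List A => seq (data A)
  end.

(* The total recursive functions on such data, in Kleene's style: the basic   *)
(* functions closed under composition, primitive recursion (on numbers and on *)
(* lists) and minimization of functions that always have a zero. The          *)
(* functions are Rocq functions, but only those generated by these schemes    *)
(* are computable in this sense; an arbitrary Rocq function, possibly         *)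
(* obtained by a choice axiom, is not.                                        *)
Inductive computable : forall A B : dtype, (data A -> data B) -> Prop :=
  | computable_ext A B (f g : data A -> data B) :
      f =1 g -> computable f -> computable g
  | computable_id A : @computable A A id
  | computable_comp A B C (f : data B -> data C) (g : data A -> data B) :
      computable f -> computable g -> @computable A C (f \o g)
  | computable_fst A B : @computable (Pair A B) A fst
  | computable_snd A B : @computable (Pair A B) B snd
  | computable_pair A B C (f : data A -> data B) (g : data A -> data C) :
      computable f -> computable g ->
      @computable A (Pair B C) (fun x => (f x, g x))
  | computable_zero A : @computable A Nat (fun=> 0%N)
  | computable_succ : @computable Nat Nat succn
  | computable_nat_rec A B (f : data A -> data B)
        (h : data (Pair A (Pair Nat B)) -> data B) :
      computable f -> computable h ->
      @computable (Pair A Nat) B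
        (fun x => iteri x.2 (fun n y => h (x.1, (n, y))) (f x.1))
  | computable_nil A B : @computable A (List B) (fun=> [::])
  | computable_cons B : @computable (Pair B (List B)) (List B)
      (fun x => x.1 :: x.2)
  | computable_list_rec A B C (f : data A -> data B)
        (h : data (Pair A (Pair C B)) -> data B) :
      computable f -> computable h ->
      @computable (Pair A (List C)) B
        (fun x => foldr (fun z y => h (x.1, (z, y))) (f x.1) x.2)
  | computable_min A (g : data (Pair A Nat) -> data Nat) (f : data A -> nat) :
      computable g ->
      (forall x, g (x, f x) = 0%N /\
                 forall m : nat, (m < f x)%N -> g (x, m) <> 0%N) ->
      @computable A Nat f.

(* (p, (m, q)) stands for the rational number (p - m) / (q + 1); every        *)
(* rational number has a code, which is not unique.                           *)
Definition rat_code : dtype := Pair Nat (Pair Nat Nat).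

Definition decode_rat (x : data rat_code) : rat :=
  (x.1%:R - x.2.1%:R) / x.2.2.+1%:R.

(* An element of a number field is given by its coordinates in a basis;       *)
(* missing coordinates count as 0 and superfluous ones are ignored.           *)
Definition elt_code : dtype := List rat_code.

(* A C-finite sequence is given by the coefficients g_0, ..., g_t of a        *)
(* recurrence, g_t <> 0, and by its initial values c(0), ..., c(t - 1).       *)
Definition cfinite_code : dtype := Pair (List elt_code) (List elt_code).

(* A C^2-finite recurrence is given by its coefficients c_0, ..., c_r.        *)
Definition c2_code : dtype := List cfinite_code.

Section Codes.
Variables (K : fieldExtType rat) (n : nat) (e : n.-tuple K).

Definition decode_elt (x : data elt_code) : K :=
  \sum_(i < n) decode_rat (nth (0%N, (0%N, 0%N)) x i) *: tnth e i.

Definition cfinite_code_for (x : data cfinite_code) (c : nat -> K) : Prop :=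
  exists t : nat,
    [/\ size x.1 = t.+1,
        size x.2 = t,
        cfinite_rec t (fun i => decode_elt (nth [::] x.1 i)) c
      & forall i : nat, (i < t)%N -> c i = decode_elt (nth [::] x.2 i)].

(* x encodes a C^2-finite recurrence of order at most r satisfied by a *)
Definition c2_code_for (r : nat) (x : data c2_code) (a : nat -> K) : Prop :=
  exists (m : nat) (c : 'I_m.+1 -> nat -> K),
    [/\ (m <= r)%N,
        size x = m.+1,
        forall i : 'I_m.+1, cfinite_code_for (nth ([::], [::]) x i) (c i)
      & c2_recurrence c a].

End Codes.

(* Main.v *)
Require Import Defs.
From mathcomp Require Import all_boot all_order all_algebra all_field.
From mathcomp Require Import ring zify.
Set Implicit Arguments.
Unset Strict Implicit.
Unset Printing Implicit Defensive.
Import GRing.Theory Num.Theory.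

(** Shift the recurrence of each a_s upwards until all of them have the same
    order M, the largest of the given orders.  Along the residue class
    n = q d + s it then reads

      sum_(i <= M) c_(s,i)(q) a_s(q + i)
        = sum_(i <= M) c_(s,i)(q) b(n + i d) = 0,

    so b satisfies a recurrence of order d M <= d r whose coefficient at j is
    zero unless j = i d, and is the interlacing of c_(0,i), ..., c_(d-1,i) if
    j = i d ([interlaced_coef], [interlaced_recurrence]).  Its leading
    coefficient is nonzero from some point on because finitely many sequences
    with this property are interlaced ([interlaced_lead]).

    The coefficients are C-finite: let P be the product of the characteristic
    polynomials of all the given coefficient sequences.  The polynomials that
    annihilate a sequence are closed under multiples, so P annihilates every
    c_(s,i) and all their shifts, and P(X^d) annihilates every interlacing of
    such sequences ([stretch_annihilates]).  One characteristic polynomial thus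
    serves for all the coefficients of the recurrence of b.

    For the computability it suffices to compute the coefficients of P(X^d) and
    sufficiently many initial values of each coefficient.  This takes ring
    operations of the number field and, to continue the given C-finite sequences
    beyond their initial values, division by leading coefficients.  In terms of
    coordinates, the inverse of y comes from the adjugate and the determinant of
    the matrix of multiplication by y, hence is a rational function of the
    coordinates of y ([coordV]).  Such functions are computable since the field
    operations of the rationals are.  Functions with values in rationals, field
    elements, lists or polynomials are handled through their codes by the notion
    [tracked].

    The existence of the recurrence without reference to codes follows, because
    every element of the field and hence every recurrence has a code. *)

(** * Computable functions on codes *)

Lemma comp_comp A B C (f : data B -> data C) (g : data A -> data B) :
  @computable B C f -> @computable A B g -> @computable A C (fun x => f (g x)).
Proof. exact: computable_comp. Qed.

Lemma comp_fst A B C (f : data A -> data (Pair B C)) :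
  @computable A (Pair B C) f -> @computable A B (fun x => (f x).1).
Proof. exact: (comp_comp (computable_fst B C)). Qed.

Lemma comp_snd A B C (f : data A -> data (Pair B C)) :
  @computable A (Pair B C) f -> @computable A C (fun x => (f x).2).
Proof. exact: (comp_comp (computable_snd B C)). Qed.

Lemma comp_succ A (f : data A -> nat) :
  @computable A Nat f -> @computable A Nat (fun x => (f x).+1).
Proof. exact: (comp_comp computable_succ). Qed.

Lemma comp_cons A B (f : data A -> data B) (g : data A -> data (List B)) :
  @computable A B f -> @computable A (List B) g ->
  @computable A (List B) (fun x => f x :: g x).
Proof.
move=> cf cg.
exact: (comp_comp (computable_cons B) (computable_pair cf cg)).
Qed.

(** Codes are finite, so each single one can be written down by constructors. *)
Lemma comp_const A B (u : data B) : @computable A B (fun=> u).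
Proof.
elim: B u => [|B IHB C IHC|B IHB] /= u.
- elim: u => [|k IHk]; [exact: computable_zero | exact: comp_succ].
- case: u => u v; exact: computable_pair (IHB u) (IHC v).
- elim: u => [|z u IHu]; [exact: computable_nil | exact: comp_cons].
Qed.

Lemma comp_iteri A B (N : data A -> nat) (f : data A -> data B)
    (h : data A -> nat -> data B -> data B) :
  @computable A Nat N -> @computable A B f ->
  @computable (Pair A (Pair Nat B)) B (fun y => h y.1 y.2.1 y.2.2) ->
  @computable A B (fun x => iteri (N x) (h x) (f x)).
Proof.
move=> cN cf ch.
exact: (comp_comp (computable_nat_rec cf ch)
                  (computable_pair (computable_id A) cN)).
Qed.

Lemma comp_foldr A B C (l : data A -> data (List C)) (f : data A -> data B)
    (h : data A -> data C -> data B -> data B) :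
  @computable A (List C) l -> @computable A B f ->
  @computable (Pair A (Pair C B)) B (fun y => h y.1 y.2.1 y.2.2) ->
  @computable A B (fun x => foldr (h x) (f x) (l x)).
Proof.
move=> cl cf ch.
exact: (comp_comp (computable_list_rec cf ch)
                  (computable_pair (computable_id A) cl)).
Qed.

(* The map [data] has no inverse that unification could use, so the code type
   of a projected pair is read off the path of projections from the variable. *)
Ltac path_dtype D y t :=
  lazymatch t with
  | y => D
  | fst ?u =>
    let P := path_dtype D y u in
    let P := eval hnf in P in lazymatch P with Pair ?B _ => B end
  | snd ?u =>
    let P := path_dtype D y u in
    let P := eval hnf in P in lazymatch P with Pair _ ?B => B end
  end.

Ltac comp_path :=
  lazymatch goal with |- @computable ?D ?B ?f =>
    let y := fresh in
    let P := constr:(fun y : data D => ltac:(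
      let t := eval cbv beta in (f y) in
      lazymatch t with
      | fst ?u => let P := path_dtype D y u in
        let P := eval hnf in P in exact P
      | snd ?u => let P := path_dtype D y u in
        let P := eval hnf in P in exact P
      end)) in
    let t := eval cbv beta in (f) in
    lazymatch P with
    | (fun _ => Pair ?B1 ?B2) =>
      first [ exact: computable_id
            | exact: (computable_fst B1 B2) | exact: (computable_snd B1 B2)
            | refine (@comp_fst D B1 B2 _ _); comp_path
            | refine (@comp_snd D B1 B2 _ _); comp_path ]
    end
  end.

Ltac comp1 := first
  [ assumption
  | exact: computable_id | exact: computable_fst | exact: computable_snd
  | exact: computable_succ | exact: comp_const
  | apply: computable_pair | apply: comp_cons
  | apply: comp_succ
  | comp_path ].
Ltac comp := repeat comp1.

Lemma comp_pred A (f : data A -> nat) :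
  @computable A Nat f -> @computable A Nat (fun x => (f x).-1).
Proof.
move=> cf.
apply: (@computable_ext A Nat (fun x => iteri (f x) (fun k _ => k) 0)).
  by move=> x; case: (f x).
by apply comp_iteri; comp.
Qed.

Lemma comp_add A (f g : data A -> nat) :
  @computable A Nat f -> @computable A Nat g ->
  @computable A Nat (fun x => f x + g x).
Proof.
move=> cf cg.
apply: (@computable_ext A Nat (fun x => iteri (f x) (fun _ => succn) (g x))).
  by move=> x; elim: (f x) => //= k ->.
by apply comp_iteri; comp.
Qed.

Lemma comp_mul A (f g : data A -> nat) :
  @computable A Nat f -> @computable A Nat g ->
  @computable A Nat (fun x => f x * g x).
Proof.
move=> cf cg.
apply: (@computable_ext A Nat
          (fun x => iteri (f x) (fun _ y => g x + y) 0)).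
  by move=> x; elim: (f x) => //= k ->.
apply comp_iteri; try apply comp_add; comp. 
by apply: (comp_comp cg); comp.
Qed.

Lemma comp_sub A (f g : data A -> nat) :
  @computable A Nat f -> @computable A Nat g ->
  @computable A Nat (fun x => f x - g x).
Proof.
move=> cf cg.
apply: (@computable_ext A Nat (fun x => iteri (g x) (fun _ => predn) (f x))).
  by move=> x; elim: (g x) => [|k /= ->]; rewrite ?subn0 // subnS.
by apply comp_iteri; try apply comp_pred; comp.
Qed.

Definition computable_test A (b : data A -> bool) :=
  @computable A Nat (fun x => b x : nat).

Lemma comp_if A B (b : data A -> bool) (f g : data A -> data B) :
  computable_test b -> @computable A B f -> @computable A B g ->
  @computable A B (fun x => if b x then f x else g x).
Proof.
move=> cb cf cg.
apply: (@computable_ext A B (fun x => iteri (b x) (fun _ _ => f x) (g x))).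
  by move=> x; case: (b x).
apply comp_iteri => //.
by apply: (comp_comp cf); comp.
Qed.

Lemma test_leq A (f g : data A -> nat) :
  @computable A Nat f -> @computable A Nat g ->
  computable_test (fun x => f x <= g x).
Proof.
move=> cf cg.
apply: (@computable_ext A Nat (fun x => 1 - (f x - g x))).
  by move=> x; rewrite /leq; case: (f x - g x).
by apply comp_sub; [comp | apply comp_sub].
Qed.

Lemma test_and A (b c : data A -> bool) :
  computable_test b -> computable_test c ->
  computable_test (fun x => b x && c x).
Proof.
move=> cb cc; apply: (@computable_ext A Nat (fun x => (b x : nat) * c x)).
  by move=> x; rewrite mulnb.
exact: comp_mul.
Qed.

Lemma test_eqn A (f g : data A -> nat) :
  @computable A Nat f -> @computable A Nat g ->
  computable_test (fun x => f x == g x).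
Proof.
move=> cf cg.
apply: (@computable_ext A Nat (fun x => (f x <= g x) && (g x <= f x))).
  by move=> x; rewrite -eqn_leq.
by apply test_and; apply test_leq.
Qed.

(** Passing from the quotient and remainder of k by d to those of k + 1 makes
    division an instance of primitive recursion. *)
Definition divmod_step d (qr : nat * nat) :=
  if d == qr.2.+1 then (qr.1.+1, 0) else (qr.1, qr.2.+1).

Lemma divmod_stepE d k : 0 < d ->
  iteri k (fun=> divmod_step d) (0, 0) = (k %/ d, k %% d).
Proof.
move=> d_gt0; elim: k => [|k IHk]; first by rewrite div0n mod0n.
have r_lt := ltn_pmod k d_gt0.
rewrite /= IHk /divmod_step /=; case: eqP => [dE|/eqP ne_d].
  have kE : k.+1 = (k %/ d).+1 * d by rewrite {1}(divn_eq k d) -addnS -dE mulSnr.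
  by rewrite kE mulnK ?modnMl.
have kE : k.+1 = k %/ d * d + (k %% d).+1 by rewrite addnS -divn_eq.
have r1_lt : (k %% d).+1 < d by rewrite ltn_neqAle eq_sym ne_d.
by rewrite kE divnMDl // modnMDl (divn_small r1_lt) (modn_small r1_lt) addn0.
Qed.

Lemma comp_divmod A (f g : data A -> nat) :
  @computable A Nat f -> @computable A Nat g ->
  @computable A (Pair Nat Nat) (fun x => (f x %/ g x, f x %% g x)).
Proof.
move=> cf cg.
apply: (@computable_ext A (Pair Nat Nat) (fun x =>
  if 0 < g x then iteri (f x) (fun=> divmod_step (g x)) (0, 0) else (0, f x))).
  move=> x; case: posnP => [->|g_gt0]; last exact: divmod_stepE.
  by rewrite divn0 modn0.
apply comp_if; first by apply test_leq; comp.
  have cgy : @computable (Pair A (Pair Nat (Pair Nat Nat))) Nat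
               (fun y => g y.1) by apply: (comp_comp cg); comp.
  apply comp_iteri => //; first by comp.
  by apply comp_if; [apply test_eqn | |]; comp.
by comp.
Qed.

Lemma comp_div A (f g : data A -> nat) :
  @computable A Nat f -> @computable A Nat g ->
  @computable A Nat (fun x => f x %/ g x).
Proof. by move=> cf cg; apply: (comp_fst (comp_divmod cf cg)). Qed.

Lemma comp_mod A (f g : data A -> nat) :
  @computable A Nat f -> @computable A Nat g ->
  @computable A Nat (fun x => f x %% g x).
Proof. by move=> cf cg; apply: (comp_snd (comp_divmod cf cg)). Qed.

Lemma test_dvd A (f g : data A -> nat) :
  @computable A Nat f -> @computable A Nat g ->
  computable_test (fun x => f x %| g x).
Proof.
by move=> cf cg; apply test_eqn; [apply comp_mod | comp].
Qed.

Lemma comp_max A (f g : data A -> nat) :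
  @computable A Nat f -> @computable A Nat g ->
  @computable A Nat (fun x => maxn (f x) (g x)).
Proof.
by move=> cf cg; rewrite /maxn; apply comp_if => //; apply test_leq; comp.
Qed.

Lemma comp_behead A B (l : data A -> data (List B)) :
  @computable A (List B) l -> @computable A (List B) (fun x => behead (l x)).
Proof.
move=> cl.
(* The fold returns the whole list next to its tail. *)
apply: (@computable_ext A (List B) (fun x =>
  (foldr (fun z (p : data (Pair (List B) (List B))) => (z :: p.1, p.1))
         ([::], [::]) (l x)).2)).
  move=> x; suff ->: foldr (fun z (p : data (Pair (List B) (List B))) =>
    (z :: p.1, p.1)) ([::], [::]) (l x) = (l x, behead (l x)) by [].
  by elim: (l x) => //= z s ->.
apply: (@comp_snd A (List B)); apply comp_foldr; comp.
Qed.

Lemma comp_nth A B (u : data B) (l : data A -> data (List B))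
    (i : data A -> nat) :
  @computable A (List B) l -> @computable A Nat i ->
  @computable A B (fun x => nth u (l x) (i x)).
Proof.
move=> cl ci.
(* The entry at i is the head of what remains after i tails. *)
apply: (@computable_ext A B (fun x =>
  foldr (fun z _ => z) u (iteri (i x) (fun=> behead) (l x)))).
  move=> x; have ->: iteri (i x) (fun=> behead) (l x) = drop (i x) (l x).
    by elim: (i x) => [|k /= ->]; rewrite ?drop0 // -drop1 drop_drop add1n.
  by rewrite -[i x in RHS]addn0 -nth_drop; case: (drop _ _).
apply comp_foldr; comp; apply comp_iteri; comp; apply comp_behead; comp.
Qed.

Lemma comp_size A B (l : data A -> data (List B)) :
  @computable A (List B) l -> @computable A Nat (fun x => size (l x)).
Proof.
move=> cl.
apply: (@computable_ext A Nat (fun x => foldr (fun _ k => k.+1) 0 (l x))).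
  by move=> x; elim: (l x) => //= z s ->.
by apply comp_foldr; comp.
Qed.

Lemma comp_mkseq A B (N : data A -> nat) (f : data A -> nat -> data B) :
  @computable (Pair A Nat) B (fun y => f y.1 y.2) -> @computable A Nat N ->
  @computable A (List B) (fun x => mkseq (f x) (N x)).
Proof.
move=> cf cN.
(* Lists grow at the head, so the entries are produced in decreasing order. *)
apply: (@computable_ext A (List B) (fun x =>
  iteri (N x) (fun k l => f x (N x - k.+1) :: l) [::])).
  move=> x; suff H k : k <= N x ->
    iteri k (fun k l => f x (N x - k.+1) :: l) [::] =
    [seq f x i | i <- iota (N x - k) k] by rewrite H // subnn.
  by elim: k => //= k IHk lt_k; rewrite IHk ?(ltnW lt_k) // subnSK.
apply comp_iteri; comp.
refine (@comp_comp (Pair A (Pair Nat (List B))) (Pair A Nat) B _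
          (fun y => (y.1, N y.1 - y.2.1.+1)) cf _).
by comp; apply comp_sub; comp; apply: (comp_comp cN); comp.
Qed.

Lemma comp_flatten A B (l : data A -> data (List (List B))) :
  @computable A (List (List B)) l ->
  @computable A (List B) (fun x => flatten (l x)).
Proof.
move=> cl; apply (@comp_foldr A (List B) (List B)); comp.
apply: (@computable_ext (Pair A (Pair (List B) (List B))) (List B)
  (fun y : data (Pair A (Pair (List B) (List B))) =>
   foldr cons y.2.2 y.2.1)).
  by move=> y; rewrite /cat; elim: y.2.1 => //= z s ->.
by apply (@comp_foldr _ (List B) B); comp.
Qed.

(** * Functions computed through codes *)

Local Open Scope ring_scope.

(** In the language of computable analysis, F is a realizer of f.  The inputs
    are codes themselves and the values are given by codes, which need not be
    unique; in this way algorithms can be stated on the decoded values. *)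
Definition tracked A D T (dec : data D -> T) (f : data A -> T) :=
  exists F, @computable A D F /\ forall x, dec (F x) = f x.

Section Tracked.
Variables (D : dtype) (T : Type) (dec : data D -> T).

Lemma tracked_ext A (f g : data A -> T) :
  f =1 g -> tracked dec f -> tracked dec g.
Proof. by move=> fg [F [cF F_f]]; exists F; split=> // x; rewrite F_f. Qed.

Lemma tracked_dec A (f : data A -> data D) :
  @computable A D f -> tracked dec (fun x => dec (f x)).
Proof. by exists f. Qed.

Lemma tracked_comp A B (f : data B -> T) (g : data A -> data B) :
  tracked dec f -> @computable A B g -> tracked dec (fun x => f (g x)).
Proof.
case=> F [cF F_f] cg; exists (fun x => F (g x)); split=> //.
exact: (comp_comp cF cg).
Qed.

Lemma tracked_if A (b : data A -> bool) (f g : data A -> T) :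
  computable_test b -> tracked dec f -> tracked dec g ->
  tracked dec (fun x => if b x then f x else g x).
Proof.
move=> cb [F [cF F_f]] [G [cG G_g]].
exists (fun x => if b x then F x else G x); split; first exact: comp_if.
by move=> x; case: (b x).
Qed.

(** The step is a function of the decoded state, which makes the result
    independent of the choice of codes during the recursion. *)
Lemma tracked_iteri A (N : data A -> nat) (f : data A -> T)
    (h : data A -> nat -> T -> T) :
  @computable A Nat N -> tracked dec f ->
  tracked dec (fun y : data (Pair A (Pair Nat D)) => h y.1 y.2.1 (dec y.2.2)) ->
  tracked dec (fun x => iteri (N x) (h x) (f x)).
Proof.
move=> cN [F [cF F_f]] [H [cH H_h]].
exists (fun x => iteri (N x) (fun k u => H (x, (k, u))) (F x)); split.
  apply: (@comp_iteri A D N F (fun x k u => H (x, (k, u)))) => //.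
  by apply: (@computable_ext _ D H) cH => -[x [k u]].
by move=> x; elim: (N x) => //= k <-; rewrite H_h.
Qed.

Lemma tracked_foldr A C (l : data A -> data (List C)) (f : data A -> T)
    (h : data A -> data C -> T -> T) :
  @computable A (List C) l -> tracked dec f ->
  tracked dec (fun y : data (Pair A (Pair C D)) => h y.1 y.2.1 (dec y.2.2)) ->
  tracked dec (fun x => foldr (h x) (f x) (l x)).
Proof.
move=> cl [F [cF F_f]] [H [cH H_h]].
exists (fun x => foldr (fun z u => H (x, (z, u))) (F x) (l x)); split.
  apply: (@comp_foldr A D C l F (fun x z u => H (x, (z, u)))) => //.
  by apply: (@computable_ext _ D H) cH => -[x [z u]].
by move=> x; elim: (l x) => //= z s <-; rewrite H_h.
Qed.

Lemma tracked_mkseq A (N : data A -> nat) (f : data A -> nat -> T) :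
  tracked dec (fun y : data (Pair A Nat) => f y.1 y.2) -> @computable A Nat N ->
  tracked (map dec : data (List D) -> seq T) (fun x => mkseq (f x) (N x)).
Proof.
case=> F [cF F_f] cN; exists (fun x => mkseq (fun i => F (x, i)) (N x)); split.
  apply: (@comp_mkseq A D N (fun x i => F (x, i))) => //.
  by apply: (@computable_ext _ D F) cF => -[x i].
by move=> x; rewrite -map_comp; apply: eq_map => i /=; rewrite F_f.
Qed.

Lemma tracked_nth A (u : data D) (l : data A -> seq T) (i : data A -> nat) :
  tracked (map dec : data (List D) -> seq T) l -> @computable A Nat i ->
  tracked dec (fun x => nth (dec u) (l x) (i x)).
Proof.
case=> L [cL L_l] ci; exists (fun x => nth u (L x) (i x)); split.
  exact: comp_nth.
move=> x; rewrite -L_l; case: (ltnP (i x) (size (L x))) => lt_i.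
  by rewrite (nth_map u).
by rewrite !nth_default ?size_map.
Qed.

Lemma tracked_size A (l : data A -> seq T) :
  tracked (map dec : data (List D) -> seq T) l ->
  @computable A Nat (fun x => size (l x)).
Proof.
case=> L [cL L_l]; apply: (@computable_ext A Nat (fun x => size (L x))).
  by move=> x; rewrite -L_l size_map.
exact: comp_size.
Qed.

End Tracked.

(** To compute an operation on tracked functions it is enough to compute it on
    decoded variables. *)
Lemma tracked_op1 D1 D T1 T (dec1 : data D1 -> T1) (dec : data D -> T)
    (op : T1 -> T) :
  tracked dec (fun u : data D1 => op (dec1 u)) ->
  forall A (f : data A -> T1), tracked dec1 f -> tracked dec (fun x => op (f x)).
Proof.
move=> [H [cH H_op]] A f [F [cF F_f]]; exists (fun x => H (F x)); split.
  exact: (comp_comp cH cF).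
by move=> x; rewrite H_op F_f.
Qed.

Lemma tracked_op2 D1 D2 D T1 T2 T (dec1 : data D1 -> T1)
    (dec2 : data D2 -> T2) (dec : data D -> T) (op : T1 -> T2 -> T) :
  tracked dec (fun u : data (Pair D1 D2) => op (dec1 u.1) (dec2 u.2)) ->
  forall A (f : data A -> T1) (g : data A -> T2),
    tracked dec1 f -> tracked dec2 g -> tracked dec (fun x => op (f x) (g x)).
Proof.
move=> [H [cH H_op]] A f g [F [cF F_f]] [G [cG G_g]].
exists (fun x => H (F x, G x)); split.
  exact: (comp_comp cH (computable_pair cF cG)).
by move=> x; rewrite H_op F_f G_g.
Qed.

(** The index list does not depend on the argument, so that this concerns a
    fixed number of operations, with a separate algorithm for each of the terms. *)
Lemma tracked_big D T (dec : data D -> T) (op : T -> T -> T) (idx : T) :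
    (forall A (f g : data A -> T), tracked dec f -> tracked dec g ->
      tracked dec (fun x => op (f x) (g x))) ->
    (forall A, tracked dec (fun _ : data A => idx)) ->
  forall A (I : Type) (r : seq I) (f : I -> data A -> T),
    (forall i, tracked dec (f i)) ->
    tracked dec (fun x => \big[op/idx]_(i <- r) f i x).
Proof.
move=> tr_op tr_idx A I r f tr_f; elim: r => [|i r IHr].
  by apply: tracked_ext (tr_idx A) => x; rewrite big_nil.
by apply: tracked_ext (tr_op _ _ _ (tr_f i) IHr) => x; rewrite big_cons.
Qed.

(** * Rational arithmetic *)

Lemma decode_rat_surj (y : rat) : exists u, decode_rat u = y.
Proof.
have [m denE] : exists m, denq y = m.+1%:Z.
  by case: (denq y) (denq_gt0 y) => [[|m]|m] //; exists m.
have [p [q numE]] : exists p q : nat, numq y = p%:Z - q%:Z.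
  case: (numq y) => p; first by exists p, 0%N; rewrite subr0.
  by exists 0%N, p.+1; rewrite sub0r NegzE.
exists (p, (q, m)).
by rewrite /decode_rat /= -[RHS]divq_num_den numE denE rmorphB.
Qed.

Lemma tracked_rat_const A (y : rat) : tracked decode_rat (fun _ : data A => y).
Proof.
have [u <-] := decode_rat_surj y.
by apply: tracked_dec; comp.
Qed.

Lemma tracked_ratD A (f g : data A -> rat) :
  tracked decode_rat f -> tracked decode_rat g ->
  tracked decode_rat (fun x => f x + g x).
Proof.
apply: tracked_op2 A f g.
exists (fun u : data (Pair rat_code rat_code) =>
  ((u.1.1 * u.2.2.2.+1 + u.2.1 * u.1.2.2.+1)%N,
   ((u.1.2.1 * u.2.2.2.+1 + u.2.2.1 * u.1.2.2.+1)%N,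
    (u.1.2.2 * u.2.2.2.+1 + u.2.2.2)%N))); split.
  by repeat first [comp1 | apply comp_add | apply comp_mul | apply comp_pred].
move=> [[p1 [m1 q1]] [p2 [m2 q2]]]; rewrite /decode_rat /=.
have -> : (q1 * q2.+1 + q2).+1 = (q1.+1 * q2.+1)%N by lia.
have [q1_neq0 q2_neq0] : q1.+1%:R != 0 :> rat /\ q2.+1%:R != 0 :> rat.
  by rewrite !pnatr_eq0.
rewrite !(natrD, natrM); move: q1_neq0 q2_neq0.
by move: q1.+1%:R q2.+1%:R => y1 y2 y1_neq0 y2_neq0; field; apply/andP.
Qed.

Lemma tracked_ratM A (f g : data A -> rat) :
  tracked decode_rat f -> tracked decode_rat g ->
  tracked decode_rat (fun x => f x * g x).
Proof.
apply: tracked_op2 A f g.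
exists (fun u : data (Pair rat_code rat_code) =>
  ((u.1.1 * u.2.1 + u.1.2.1 * u.2.2.1)%N,
   ((u.1.1 * u.2.2.1 + u.1.2.1 * u.2.1)%N,
    (u.1.2.2 * u.2.2.2.+1 + u.2.2.2)%N))); split.
  by repeat first [comp1 | apply comp_add | apply comp_mul | apply comp_pred].
move=> [[p1 [m1 q1]] [p2 [m2 q2]]]; rewrite /decode_rat /=.
have -> : (q1 * q2.+1 + q2).+1 = (q1.+1 * q2.+1)%N by lia.
have [q1_neq0 q2_neq0] : q1.+1%:R != 0 :> rat /\ q2.+1%:R != 0 :> rat.
  by rewrite !pnatr_eq0.
rewrite !(natrD, natrM); move: q1_neq0 q2_neq0.
by move: q1.+1%:R q2.+1%:R => y1 y2 y1_neq0 y2_neq0; field; apply/andP.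
Qed.

Lemma tracked_ratV A (f : data A -> rat) :
  tracked decode_rat f -> tracked decode_rat (fun x => (f x)^-1).
Proof.
apply: tracked_op1 A f.
(* One of p - m and m - p vanishes by truncation and their sum D is |p - m|;
   ((q + 1)(p - m)) / D^2 is then the inverse, or 0 if p = m. *)
exists (fun u : data rat_code =>
  (u.2.2.+1 * (u.1 - u.2.1), (u.2.2.+1 * (u.2.1 - u.1),
    (((u.1 - u.2.1) + (u.2.1 - u.1)) * ((u.1 - u.2.1) + (u.2.1 - u.1))).-1))%N); split.
  by repeat first [comp1 | apply comp_add | apply comp_mul | apply comp_pred
                   | apply comp_sub].
move=> [p [m q]]; rewrite /decode_rat /=.
have q_neq0 : q.+1%:R != 0 :> rat by rewrite pnatr_eq0.
case: (ltngtP p m) => [lt_pm|lt_mp|->].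
- have -> : (p - m = 0)%N by apply/eqP; rewrite subn_eq0 ltnW.
  have d_neq0 : m%:R - p%:R != 0 :> rat.
    by rewrite subr_eq0 eqr_nat gtn_eqF.
  rewrite muln0 add0n prednK ?muln_gt0 ?subn_gt0 ?lt_pm //.
  rewrite !natrM natrB ?(ltnW lt_pm) //.
  move: q.+1%:R q_neq0 d_neq0 => y y_neq0 d_neq0.
  by field; rewrite y_neq0 d_neq0 -opprB oppr_eq0 d_neq0.
- have -> : (m - p = 0)%N by apply/eqP; rewrite subn_eq0 ltnW.
  have d_neq0 : p%:R - m%:R != 0 :> rat.
    by rewrite subr_eq0 eqr_nat gtn_eqF.
  rewrite muln0 addn0 prednK ?muln_gt0 ?subn_gt0 ?lt_mp //.
  rewrite !natrM natrB ?(ltnW lt_mp) //.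
  move: q.+1%:R q_neq0 d_neq0 => y y_neq0 d_neq0.
  by field; rewrite y_neq0 d_neq0.
by rewrite subnn muln0 !subrr !mul0r invr0.
Qed.

Lemma tracked_rat_sum A (I : Type) (r : seq I) (f : I -> data A -> rat) :
  (forall i, tracked decode_rat (f i)) ->
  tracked decode_rat (fun x => \sum_(i <- r) f i x).
Proof.
apply: tracked_big => B; first exact: tracked_ratD.
exact: tracked_rat_const.
Qed.

Lemma tracked_rat_prod A (I : Type) (r : seq I) (f : I -> data A -> rat) :
  (forall i, tracked decode_rat (f i)) ->
  tracked decode_rat (fun x => \prod_(i <- r) f i x).
Proof.
apply: tracked_big => B; first exact: tracked_ratM.
exact: tracked_rat_const.
Qed.

(** The Leibniz formula for matrices of a fixed size. *)
Lemma tracked_det A n (M : data A -> 'M[rat]_n) :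
  (forall i j, tracked decode_rat (fun x => M x i j)) ->
  tracked decode_rat (fun x => \det (M x)).
Proof.
move=> tr_M; apply: tracked_rat_sum => s.
apply: tracked_ratM; first exact: tracked_rat_const.
by apply: tracked_rat_prod => i; apply: tr_M.
Qed.

(** * Arithmetic of the number field *)

Section NumberField.
Variables (K : fieldExtType rat) (n : nat) (e : n.-tuple K).
Hypothesis basis_e : basis_of fullv e.

Local Notation trackedK := (tracked (decode_elt e)).

Lemma coord_decode_elt u (i : 'I_n) :
  coord e i (decode_elt e u) = decode_rat (nth (0, (0, 0))%N u i).
Proof.
have free_e := basis_free basis_e.
under [decode_elt e u]eq_bigr => j _ do rewrite (tnth_nth 0).
by rewrite (coord_sum_free _ _ free_e).
Qed.

Lemma decode_elt_coord (y : K) : y = \sum_(i < n) coord e i y *: tnth e i.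
Proof.
rewrite {1}(coord_basis basis_e (memvf y)).
by apply: eq_bigr => i _; rewrite (tnth_nth 0).
Qed.

Lemma trackedK_coord A (f : data A -> K) i :
  trackedK f -> tracked decode_rat (fun x => coord e i (f x)).
Proof.
case=> F [cF F_f].
exists (fun x => nth (0, (0, 0))%N (F x) i); split.
  by apply: (comp_nth (B := rat_code)) cF _; comp.
by move=> x; rewrite -F_f coord_decode_elt.
Qed.

(** There are finitely many coordinates, hence one algorithm for each. *)
Lemma trackedK_of_coord A (f : data A -> K) :
  (forall i, tracked decode_rat (fun x => coord e i (f x))) -> trackedK f.
Proof.
case/fin_all_exists=> F F_f.
exists (fun x => [seq F i x | i <- enum 'I_n]); split.
  elim: (enum _) => [|i r IHr] /=; comp.
  exact: (proj1 (F_f i)).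
move=> x; rewrite [f x]decode_elt_coord; apply: eq_bigr => i _.
have [_ <-] := F_f i.
by rewrite (nth_map i) ?size_enum_ord // nth_ord_enum.
Qed.

Lemma trackedK_const A (y : K) : trackedK (fun _ : data A => y).
Proof. by apply: trackedK_of_coord => i; apply: tracked_rat_const. Qed.

Lemma trackedKD A (f g : data A -> K) :
  trackedK f -> trackedK g -> trackedK (fun x => f x + g x).
Proof.
move=> tr_f tr_g; apply: trackedK_of_coord => i.
apply: (tracked_ext (f := fun x => coord e i (f x) + coord e i (g x))).
  by move=> x; rewrite linearD.
by apply: tracked_ratD; apply: trackedK_coord.
Qed.

(** The products of basis elements have rational coordinates that do not depend
    on y and z: they are constants of the algorithm. *)
Lemma coordM (y z : K) k : coord e k (y * z) =
  \sum_(i < n) coord e i y * \sum_(j < n) coord e j z * coord e k (tnth e i * tnth e j).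
Proof.
rewrite {1}[y]decode_elt_coord mulr_suml linear_sum.
apply: eq_bigr => i _; rewrite -scalerAl linearZ; congr (_ * _).
rewrite {1}[z]decode_elt_coord mulr_sumr linear_sum.
by apply: eq_bigr => j _; rewrite -scalerAr linearZ.
Qed.

Lemma trackedKM A (f g : data A -> K) :
  trackedK f -> trackedK g -> trackedK (fun x => f x * g x).
Proof.
move=> tr_f tr_g; apply: trackedK_of_coord => k.
apply: tracked_ext => [x|]; first by rewrite coordM.
apply: tracked_rat_sum => i; apply: tracked_ratM; first exact: trackedK_coord.
apply: tracked_rat_sum => j; apply: tracked_ratM; first exact: trackedK_coord.
exact: tracked_rat_const.
Qed.

Lemma trackedKN A (f : data A -> K) :
  trackedK f -> trackedK (fun x => - f x).
Proof.
move=> tr_f; apply: (tracked_ext (f := fun x => -1 * f x)).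
  by move=> x; rewrite mulN1r.
by apply: trackedKM => //; apply: trackedK_const.
Qed.

Definition coord_row (y : K) : 'rV[rat]_n := \row_i coord e i y.

(** Row vectors are multiplied from the right, so this is the matrix of
    multiplication by y in the basis e. *)
Definition mul_mx (y : K) : 'M[rat]_n := \matrix_(i, k) coord e k (tnth e i * y).

Lemma coord_row_mul y z : coord_row y *m mul_mx z = coord_row (y * z).
Proof.
apply/rowP=> k; rewrite !mxE {2}[y]decode_elt_coord mulr_suml linear_sum.
by apply: eq_bigr => i _; rewrite !mxE -scalerAl linearZ.
Qed.

Lemma mul_mxM y z : mul_mx y *m mul_mx z = mul_mx (y * z).
Proof.
apply/row_matrixP=> i; rewrite row_mul.
have row_mul_mx w : row i (mul_mx w) = coord_row (tnth e i * w).
  by apply/rowP=> k; rewrite !mxE.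
by rewrite !row_mul_mx coord_row_mul mulrA.
Qed.

Lemma mul_mx1 : mul_mx 1 = 1%:M.
Proof.
apply/matrixP=> i k; rewrite !mxE mulr1 (tnth_nth 0).
by rewrite coord_free ?(basis_free basis_e) // eq_sym.
Qed.

(** Since K is not the zero space, [mul_mx 0] is a zero matrix of positive
    size. *)
Lemma det_mul_mx0 : \det (mul_mx 0) = 0.
Proof.
apply/eqP; apply: contraTT (oner_neq0 K); rewrite -unitfE negbK => det_unit.
have : coord_row 1 *m mul_mx 0 *m invmx (mul_mx 0) = 0.
  rewrite (_ : mul_mx 0 = 0) ?mulmx0 ?mul0mx //.
  by apply/matrixP=> i k; rewrite !mxE mulr0 linear0.
rewrite mulmxK // => /rowP one0.
rewrite [1]decode_elt_coord big1 // => i _.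
by have := one0 i; rewrite !mxE => ->; rewrite scale0r.
Qed.

(** The coordinates of the inverse solve the linear system
    [coord_row y^-1 *m mul_mx y = coord_row 1].  Writing the solution by
    Cramer's rule keeps the formula valid at y = 0, where both sides vanish. *)
Lemma coordV y i :
  coord e i y^-1 = (\det (mul_mx y))^-1 * (coord_row 1 *m \adj (mul_mx y)) 0 i.
Proof.
have [->|y_neq0] := eqVneq y 0.
  by rewrite det_mul_mx0 !invr0 mul0r linear0.
have y_unit : mul_mx y \in unitmx.
  have : mul_mx y *m mul_mx y^-1 = 1%:M by rewrite mul_mxM divff // mul_mx1.
  by case/mulmx1_unit.
have <- : coord_row y^-1 0 i = coord e i y^-1 by rewrite mxE.
have -> : coord_row y^-1 = coord_row 1 *m invmx (mul_mx y).
  by rewrite -[LHS](mulmxK y_unit) coord_row_mul mulVf.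
by rewrite /invmx y_unit -scalemxAr mxE.
Qed.

Lemma trackedKV A (f : data A -> K) :
  trackedK f -> trackedK (fun x => (f x)^-1).
Proof.
move=> tr_f; apply: trackedK_of_coord => k.
apply: tracked_ext => [x|]; first by rewrite coordV.
have tr_M i j : tracked decode_rat (fun x => mul_mx (f x) i j).
  apply: (tracked_ext (f := fun x => coord e j (tnth e i * f x))).
    by move=> x; rewrite mxE.
  by apply/trackedK_coord/trackedKM => //; apply: trackedK_const.
apply: tracked_ratM; first by apply/tracked_ratV/tracked_det.
apply: tracked_ext => [x|]; first by rewrite mxE.
apply: tracked_rat_sum => i; apply: tracked_ratM.
  exact: tracked_rat_const.
apply: tracked_ext => [x|]; first by rewrite mxE.
apply: tracked_ratM; first exact: tracked_rat_const.
apply: tracked_det => j l.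
by apply: tracked_ext (tr_M (lift k j) (lift i l)) => x; rewrite !mxE.
Qed.

Lemma trackedK_sum A (N : data A -> nat) (f : data A -> nat -> K) :
  @computable A Nat N -> trackedK (fun y : data (Pair A Nat) => f y.1 y.2) ->
  trackedK (fun x => \sum_(i < N x) f x i).
Proof.
move=> cN tr_f.
apply: (tracked_ext (f := fun x => iteri (N x) (fun k s => s + f x k) 0)).
  by move=> x; elim: (N x) => [|k IHk]; rewrite ?big_ord0 // big_ord_recr -IHk.
apply: tracked_iteri => //; first exact: trackedK_const.
apply: trackedKD; first by apply: tracked_dec; comp.
refine (tracked_comp (g := fun y : data (Pair A (Pair Nat elt_code)) =>
  (y.1, y.2.1) : data (Pair A Nat)) tr_f _).
by comp.
Qed.

Lemma decode_elt_nil : decode_elt e [::] = 0.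
Proof.
by rewrite /decode_elt big1 // => i _; rewrite nth_nil /decode_rat subrr !mul0r scale0r.
Qed.

Local Notation trackedKs :=
  (tracked (map (decode_elt e) : data (List elt_code) -> seq K)).

Lemma trackedK_nth A (l : data A -> seq K) (i : data A -> nat) :
  trackedKs l -> @computable A Nat i -> trackedK (fun x => (l x)`_(i x)).
Proof.
by move=> tr_l ci; have := tracked_nth ([::] : data elt_code) tr_l ci;
  rewrite decode_elt_nil.
Qed.

(** * Polynomials over the number field *)

(** Lists with trailing zeros are allowed, so that no coefficient has to be
    tested for zero. *)
Definition decode_poly (l : data (List elt_code)) : {poly K} :=
  Poly (map (decode_elt e) l).
Local Notation trackedP := (tracked decode_poly).

Lemma trackedP_coef A (p : data A -> {poly K}) (i : data A -> nat) :
  trackedP p -> @computable A Nat i -> trackedK (fun x => (p x)`_(i x)).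
Proof.
case=> L [cL L_p] ci.
apply: (tracked_ext (f := fun x => (map (decode_elt e) (L x))`_(i x))).
  by move=> x; rewrite -L_p coef_Poly.
by apply: trackedK_nth => //; exact: tracked_dec.
Qed.

(** The degree need not be computed exactly: an upper bound is enough to list
    the coefficients. *)
Lemma trackedP_of_coef A (p : data A -> {poly K}) (N : data A -> nat) :
  @computable A Nat N -> (forall x, (size (p x) <= N x)%N) ->
  trackedK (fun y : data (Pair A Nat) => (p y.1)`_y.2) -> trackedP p.
Proof.
move=> cN le_pN tr_p.
have [L [cL L_p]] := tracked_mkseq (f := fun x i => (p x)`_i) tr_p cN.
exists L; split=> // x; apply/polyP=> i; rewrite coef_Poly L_p.
case: (ltnP i (N x)) => lt_i; first by rewrite nth_mkseq.
rewrite !nth_default ?size_mkseq //; exact: leq_trans lt_i.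
Qed.

Lemma trackedPM A (p q : data A -> {poly K}) :
  trackedP p -> trackedP q -> trackedP (fun x => p x * q x).
Proof.
apply: tracked_op2 A p q.
have size_dec l : (size (decode_poly l) <= size l)%N.
  by apply: leq_trans (size_Poly _) _; rewrite size_map.
apply: (trackedP_of_coef (N := fun u : data (Pair (List elt_code) (List elt_code))
  => (size u.1 + size u.2)%N)).
- by apply comp_add; apply (@comp_size _ elt_code); comp.
- move=> [l1 l2] /=; apply: leq_trans (size_polyMleq _ _) _.
  by apply: leq_trans (leq_pred _) _; apply: leq_add.
pose D : dtype := Pair (List elt_code) (List elt_code).
apply: tracked_ext => [x|]; first by rewrite coefM.
apply: (trackedK_sum (f := fun (x : data (Pair D Nat)) (i : nat) =>
   (decode_poly x.1.1)`_i * (decode_poly x.1.2)`_(x.2 - i))).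
  by comp.
apply: trackedKM; apply: trackedP_coef; try apply: tracked_dec; comp.
by apply comp_sub; comp.
Qed.

(** * Terms of a C-finite sequence *)

(** If g is the list of coefficients of a recurrence of order t and w is a
    window c(k), ..., c(k + t - 1), this is c(k + t). *)
Definition next_term (g w : seq K) : K :=
  - (g`_(size g).-1)^-1 * \sum_(i < (size g).-1) g`_i * w`_i.

Definition slide (g w : seq K) : seq K :=
  mkseq (fun i => if (i.+1 < (size g).-1)%N then w`_i.+1 else next_term g w)
        (size g).-1.

Definition cfinite_term (g w : seq K) (k : nat) : K :=
  (iteri k (fun=> slide g) w)`_0.

Lemma cfinite_termE (g w : seq K) (t : nat) (c : nat -> K) :
  size g = t.+1 -> size w = t -> cfinite_rec t (fun i => g`_i) c ->
  (forall i, (i < t)%N -> c i = w`_i) -> cfinite_term g w =1 c.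
Proof.
move=> size_g size_w [g_t rec_c] init_c k; rewrite /cfinite_term.
have -> : iteri k (fun=> slide g) w = mkseq (fun i => c (k + i)%N) t.
  elim: k => [|k /= ->].
    apply: (@eq_from_nth _ 0) => [|i]; first by rewrite size_mkseq.
    by rewrite size_w => lt_i; rewrite nth_mkseq ?init_c.
  rewrite /slide size_g /=; apply: (@eq_from_nth _ 0) => [|i]; rewrite !size_mkseq //.
  move=> lt_i; rewrite nth_mkseq // [RHS]nth_mkseq //; case: ltnP => [lt_i1|le_t].
    by rewrite nth_mkseq // addSnnS.
  have ti : t = i.+1 by apply/eqP; rewrite eqn_leq lt_i le_t.
  have -> : (k.+1 + i = k + t)%N by rewrite ti addSnnS.
  have /eqP := rec_c k; rewrite big_ord_recr /= addr_eq0 => /eqP sumE.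
  rewrite /next_term size_g /=.
  under eq_bigr => j _ do rewrite nth_mkseq //.
  by rewrite sumE mulNr mulrN opprK mulKf.
(* In order 0 the window is empty, and the recurrence forces c = 0, the default
   value. *)
case: (posnP t) => [t0|t_gt0]; last by rewrite nth_mkseq // addn0.
rewrite t0 nth_nil; have := rec_c k.
rewrite {}t0 in g_t *.
by rewrite big_ord_recl big_ord0 addr0 addn0 => /eqP;
  rewrite mulf_eq0 (negPf g_t) => /eqP.
Qed.

Lemma tracked_next_term A (g w : data A -> seq K) :
  trackedKs g -> trackedKs w -> trackedK (fun x => next_term (g x) (w x)).
Proof.
move=> tr_g tr_w.
have c_t : @computable A Nat (fun x => (size (g x)).-1).
  by apply: comp_pred; apply: tracked_size tr_g.
apply: trackedKM; first by apply/trackedKN/trackedKV; apply: trackedK_nth.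
apply: (trackedK_sum (f := fun x i => (g x)`_i * (w x)`_i)) => //.
apply: trackedKM; apply: trackedK_nth; comp.
  by apply: (tracked_comp tr_g); comp.
by apply: (tracked_comp tr_w); comp.
Qed.

Lemma tracked_slide A (g w : data A -> seq K) :
  trackedKs g -> trackedKs w -> trackedKs (fun x => slide (g x) (w x)).
Proof.
move=> tr_g tr_w.
have c_t : @computable A Nat (fun x => (size (g x)).-1).
  by apply: comp_pred; apply: tracked_size tr_g.
apply: tracked_mkseq => //; apply: tracked_if.
- by apply: test_leq; comp; apply: (comp_comp c_t); comp.
- by apply: trackedK_nth; comp; apply: (tracked_comp tr_w); comp.
by apply: (tracked_comp (tracked_next_term tr_g tr_w)); comp.
Qed.

Lemma tracked_cfinite_term A (g w : data A -> seq K) (k : data A -> nat) :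
  trackedKs g -> trackedKs w -> @computable A Nat k ->
  trackedK (fun x => cfinite_term (g x) (w x) (k x)).
Proof.
move=> tr_g tr_w ck.
apply: trackedK_nth; comp; apply: tracked_iteri => //.
apply: tracked_slide; first by apply: (tracked_comp tr_g); comp.
by apply: tracked_dec; comp.
Qed.

End NumberField.

(** * Annihilating polynomials *)

Section Annihilator.
Variable K : fieldType.
Implicit Types (p q : {poly K}) (c : nat -> K).

Definition shift_act p c k := \sum_(i < size p) p`_i * c (k + i)%N.

(** Sums up to any bound on the degree make the action visibly linear in p. *)
Lemma shift_actE N p c k : (size p <= N)%N ->
  shift_act p c k = \sum_(i < N) p`_i * c (k + i)%N.
Proof.
move=> le_pN; rewrite /shift_act -!(big_mkord xpredT (fun i => p`_i * c (k + i)%N)).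
rewrite (big_cat_nat _ le_pN) //= [X in _ + X]big_nat_cond.
rewrite [X in _ + X]big1 ?addr0 // => i.
by case/andP=> /andP[le_pi _] _; rewrite nth_default ?mul0r.
Qed.

Definition annihilates p c := forall k, shift_act p c k = 0.

(** The annihilator is an ideal, since multiplication by X amounts to shifting
    the sequence. *)
Lemma annihilates_mul p q c : annihilates p c -> annihilates (q * p) c.
Proof.
move=> p_c; elim/poly_ind: q => [|q a IHq] k.
  by rewrite mul0r /shift_act size_poly0 big_ord0.
have -> : (q * 'X + a%:P) * p = (q * p) * 'X + a *: p.
  by rewrite mulrDl mul_polyC mulrAC.
set N := maxn (size (q * p)) (size p).
have le_qp : (size (q * p)%R <= N)%N by apply: leq_maxl.
have le_p : (size p <= N)%N by apply: leq_maxr.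
rewrite (@shift_actE N.+1); last first.
  apply: leq_trans (size_polyD _ _) _; rewrite geq_max; apply/andP; split.
    by apply: leq_trans (size_polyMleq _ _) _; rewrite size_polyX addn2.
  by apply: leq_trans (size_scale_leq _ _) _; apply: leqW.
under eq_bigr => i _ do rewrite coefD coefZ mulrDl -[a * _ * _]mulrA.
rewrite big_split /= -mulr_sumr -(shift_actE c k (leqW le_p)) p_c mulr0 addr0.
rewrite big_ord_recl coefMX mul0r add0r -[RHS](IHq k.+1) (shift_actE _ _ le_qp).
by apply: eq_bigr => i _; rewrite coefMX /= addSnnS.
Qed.

Lemma annihilates_shift p c m :
  annihilates p c -> annihilates p (fun k => c (k + m)%N).
Proof.
move=> p_c k; rewrite -[RHS](p_c (k + m)%N).
by apply: eq_bigr => i _; rewrite addnAC.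
Qed.

Lemma annihilates0 p : annihilates p (fun=> 0).
Proof. by move=> k; rewrite /shift_act big1 // => i _; rewrite mulr0. Qed.

Lemma annihilates_ext p c c' : c =1 c' -> annihilates p c -> annihilates p c'.
Proof.
by move=> cc' p_c k; rewrite -[RHS](p_c k); apply: eq_bigr => i _; rewrite cc'.
Qed.

End Annihilator.

Lemma sum_multiples (V : nmodType) d t (G : nat -> V) : (0 < d)%N ->
  (forall k, ~~ (d %| k)%N -> G k = 0) ->
  \sum_(k < (d * t).+1) G k = \sum_(i < t.+1) G (i * d)%N.
Proof.
move=> d_gt0 G0; elim: t => [|t IHt]; first by rewrite muln0 !big_ord1.
rewrite [RHS]big_ord_recr -IHt /= -!(big_mkord xpredT G).
have le_t : ((d * t).+1 <= d * t.+1)%N by rewrite mulnS; lia.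
rewrite (@big_cat_nat _ _ _ (d * t).+1) ?leqW //=.
rewrite [X in _ + X]big_nat_recr //=.
rewrite [X in _ + (X + _)]big_nat_cond.
rewrite [X in _ + (X + _)]big1 ?add0r [(d * t.+1)%N]mulnC // => k.
case/andP=> /andP[lt_k k_lt] _; apply: G0; apply/negP => /dvdnP[q kE].
by move: lt_k k_lt; rewrite {}kE ![(_ * d)%N]mulnC !ltn_pmul2l //; lia.
Qed.

(** The weights are the coefficients of p(X^d), possibly padded by zeros.  They
    only see the terms whose index has the residue of k, which form a segment of
    a single sequence c s. *)
Lemma stretch_annihilates (K : fieldType) d t (p : {poly K})
    (c : nat -> nat -> K) (b : nat -> K) :
  (0 < d)%N -> (size p <= t.+1)%N ->
  (forall s, (s < d)%N -> annihilates p (c s)) ->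
  (forall q s, (s < d)%N -> b (q * d + s)%N = c s q) ->
  forall k, \sum_(i < (d * t).+1)
    (if (d %| i)%N then p`_(i %/ d) else 0) * b (k + i)%N = 0.
Proof.
move=> d_gt0 le_pt p_c bE k.
rewrite (@sum_multiples _ d t
  (fun i => (if (d %| i)%N then p`_(i %/ d) else 0) * b (k + i)%N)) //; last first.
  by move=> i /negPf->; rewrite mul0r.
have k_lt := ltn_pmod k d_gt0.
rewrite -[RHS](p_c _ k_lt (k %/ d)%N) (shift_actE _ _ le_pt).
apply: eq_bigr => i _; rewrite dvdn_mull // mulnK //.
by rewrite {1}(divn_eq k d) addnAC -mulnDl bE.
Qed.

(** * The recurrence of the interlacing *)

Section Algorithm.
Variables (K : fieldExtType rat) (n : nat) (e : n.-tuple K).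
Hypothesis basis_e : basis_of fullv e.

Local Notation trackedK := (tracked (decode_elt e)).
Local Notation trackedKs :=
  (tracked (map (decode_elt e) : data (List elt_code) -> seq K)).
Local Notation trackedP := (tracked (decode_poly e)).
Local Notation decs := (map (decode_elt e)).

Lemma decode_elt_nth (l : data (List elt_code)) i :
  decode_elt e (nth [::] l i) = (decs l)`_i.
Proof.
case: (ltnP i (size l)) => lt_i; first by rewrite (nth_map ([::] : data elt_code)).
by rewrite !nth_default ?size_map // decode_elt_nil.
Qed.

Definition code_term (z : data cfinite_code) (k : nat) : K :=
  cfinite_term (decs z.1) (decs z.2) k.

Lemma code_termE z c : cfinite_code_for e z c -> code_term z =1 c.
Proof.
case=> t [size_g size_w rec_c init_c].
apply: (cfinite_termE (t := t)); rewrite ?size_map //.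
  case: rec_c => g_t rec_c; split=> [|k]; first by rewrite -decode_elt_nth.
  by rewrite -[RHS](rec_c k); apply: eq_bigr => i _; rewrite -decode_elt_nth.
by move=> i /init_c ->; rewrite decode_elt_nth.
Qed.

Lemma size_decode_poly z c :
  cfinite_code_for e z c -> size (decode_poly e z.1) = (size z.1).-1.+1.
Proof.
case=> t [size_g _ [g_t _] _]; rewrite size_g /=.
suff -> : decode_poly e z.1 = decs z.1 :> seq K by rewrite size_map size_g.
apply: (PolyK (c := 0)); rewrite -nth_last size_map size_g.
by rewrite -decode_elt_nth.
Qed.

Lemma decode_poly_annihilates z c :
  cfinite_code_for e z c -> annihilates (decode_poly e z.1) (code_term z).
Proof.
move=> z_c; apply: annihilates_ext (fun k => esym (code_termE z_c k)) _.
case: z_c => t [size_g _ [_ rec_c] _] k.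
rewrite (@shift_actE _ t.+1); last first.
  by apply: leq_trans (size_Poly _) _; rewrite size_map size_g.
by rewrite -[RHS](rec_c k); apply: eq_bigr => i _; rewrite coef_Poly decode_elt_nth.
Qed.

Definition poly_prod (X : data (List cfinite_code)) : {poly K} :=
  foldr (fun (z : data cfinite_code) p => decode_poly e z.1 * p) 1 X.

(** The degree of [poly_prod X] if all entries of X are valid codes; unlike that
    degree it is computable without testing coefficients for zero. *)
Definition degree_sum (X : data (List cfinite_code)) : nat :=
  foldr (fun (z : data cfinite_code) t => (size z.1).-1 + t)%N 0%N X.

Lemma size_poly_prod X :
  (forall z, z \in X -> exists c, cfinite_code_for e z c) ->
  size (poly_prod X) = (degree_sum X).+1.
Proof.
elim: X => [|z X IHX] X_ok; first by rewrite /poly_prod size_poly1.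
have [c z_c] := X_ok z (mem_head _ _).
have size_X := IHX (fun y Xy => X_ok y (mem_behead (s := z :: X) Xy)).
rewrite /= size_mul -?size_poly_gt0 ?(size_decode_poly z_c) ?size_X //.
by rewrite addSn addnS.
Qed.

Lemma poly_prod_annihilates X z c :
  cfinite_code_for e z c -> z \in X -> annihilates (poly_prod X) (code_term z).
Proof.
move=> z_c; elim: X => //= y X IHX; rewrite inE => /orP[/eqP <-|Xz].
  by rewrite mulrC; apply/annihilates_mul/(decode_poly_annihilates z_c).
exact/annihilates_mul/IHX.
Qed.

Definition max_order (R : data (List c2_code)) : nat :=
  foldr (fun (x : data c2_code) M => maxn (size x).-1 M) 0%N R.

Lemma max_orderP (R : data (List c2_code)) r :
  reflect (forall x, x \in R -> (size x).-1 <= r)%N (max_order R <= r)%N.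
Proof.
apply: (iffP idP) => [|le_r].
  elim: R => //= x R IHR; rewrite geq_max => /andP[le_x le_R] y.
  by rewrite inE => /orP[/eqP->|/(IHR le_R)].
elim: R le_r => //= x R IHR le_r; rewrite geq_max le_r ?mem_head //=.
by apply: IHR => y Ry; apply: le_r; rewrite inE Ry orbT.
Qed.

Definition component (R : data (List c2_code)) k : data c2_code :=
  nth [::] R (k %% size R)%N.

(** The number of steps by which the recurrence in class k mod d is shifted to
    reach the order [max_order R]: a list of length m + 1 encodes order m. *)
Definition lag R k := ((max_order R).+1 - size (component R k))%N.

(** The recurrence of order m shifted by l has the coefficients
    0, ..., 0, c_0(q + l), ..., c_m(q + l), with l zeros. *)
Definition interlaced_coef (R : data (List c2_code)) (j k : nat) : K :=
  let i := (j %/ size R)%N in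
  if (size R %| j)%N && (lag R k <= i)%N then
    code_term (nth ([::], [::]) (component R k) (i - lag R k))
              (k %/ size R + lag R k)
  else 0.

(** The coefficients of P(X^d) for the product P of all characteristic
    polynomials. *)
Definition interlaced_char (R : data (List c2_code)) : seq K :=
  mkseq (fun i => if (size R %| i)%N then
                    (poly_prod (flatten R))`_(i %/ size R) else 0)
        (size R * degree_sum (flatten R)).+1.

Section Correctness.
Variables (d r : nat) (a : 'I_d -> nat -> K) (b : nat -> K).
Variable R : data (List c2_code).
Hypotheses (d_gt0 : (0 < d)%N) (size_R : size R = d).
Hypothesis R_a : forall s : 'I_d, c2_code_for e r (nth [::] R s) (a s).
Hypothesis b_a : interlacing a b.

Lemma codes_valid z : z \in flatten R -> exists c, cfinite_code_for e z c.
Proof.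
case/flattenP=> x /(nthP [::])[s]; rewrite size_R => lt_s <- /(nthP ([::], [::])).
case=> i lt_i <-; have [m [c [_ size_x x_c _]]] := R_a (Ordinal lt_s).
by rewrite size_x in lt_i; exists (c (Ordinal lt_i)); apply: (x_c (Ordinal lt_i)).
Qed.

Lemma max_order_le : (max_order R <= r)%N.
Proof.
apply/max_orderP=> x /(nthP [::])[s]; rewrite size_R => lt_s <-.
by have [m [c [le_m -> _ _]]] := R_a (Ordinal lt_s).
Qed.

Lemma component_facts (s : 'I_d) : let x := nth [::] R s in
  [/\ (0 < size x)%N,
      exists k0, forall k, (k0 <= k)%N ->
        code_term (nth ([::], [::]) x (size x).-1) k != 0
    & forall k, \sum_(i < size x)
        code_term (nth ([::], [::]) x i) k * a s (k + i)%N = 0].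
Proof.
have [m [c [_ size_x x_c [_ [k0 c_neq0] rec_a]]]] := R_a s.
move=> x; rewrite size_x; split=> //.
  by exists k0 => k le_k; rewrite (code_termE (x_c ord_max)) c_neq0.
move=> k; rewrite -[RHS](rec_a k); apply: eq_bigr => i _.
by rewrite (code_termE (x_c i)).
Qed.

Lemma interlaced_coefE (j q s : nat) : (s < d)%N ->
  interlaced_coef R j (q * d + s) =
  if (d %| j)%N && (lag R s <= j %/ d)%N then
    code_term (nth ([::], [::]) (nth [::] R s) (j %/ d - lag R s)) (q + lag R s)
  else 0.
Proof.
move=> lt_s; rewrite /interlaced_coef /lag /component size_R.
by rewrite modnMDl (modn_small lt_s) divnMDl // (divn_small lt_s) addn0.
Qed.

Lemma lagE s : (s < d)%N ->
  lag R s = ((max_order R).+1 - size (nth [::] R s))%N.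
Proof. by move=> lt_s; rewrite /lag /component size_R modn_small. Qed.

Lemma size_component (s : 'I_d) : (size (nth [::] R s) <= (max_order R).+1)%N.
Proof.
have/max_orderP le_max := leqnn (max_order R).
apply: leq_trans (leqSpred _) _; rewrite ltnS; apply: le_max.
by rewrite mem_nth ?size_R.
Qed.

Lemma interlaced_recurrence k :
  \sum_(j < (d * max_order R).+1) interlaced_coef R j k * b (k + j)%N = 0.
Proof.
rewrite (@sum_multiples _ d _ (fun j => interlaced_coef R j k * b (k + j)%N)) //.
  2: by move=> j /negPf nd_j; rewrite /interlaced_coef size_R nd_j mul0r.
have lt_s := ltn_pmod k d_gt0; set q := (k %/ d)%N; set s := Ordinal lt_s.
have [size_gt0 _ rec_a] := component_facts s.
have lag_s : lag R s = ((max_order R).+1 - size (nth [::] R s))%N := lagE lt_s.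
have le_size := size_component s.
have -> : k = (q * d + s)%N by exact: divn_eq.
transitivity (\sum_(0 <= i < (max_order R).+1) (if (lag R s <= i)%N then
  code_term (nth ([::], [::]) (nth [::] R s) (i - lag R s)) (q + lag R s)
  else 0) * a s (q + i)%N).
  rewrite big_mkord; apply: eq_bigr => i _.
  rewrite (interlaced_coefE _ _ lt_s) dvdn_mull //= mulnK //.
  by rewrite addnAC -mulnDl (b_a (q + i) s).
rewrite (@big_cat_nat _ _ _ (lag R s)) //=; last by rewrite lag_s leq_subr.
rewrite big_nat_cond big1 => [|i]; last first.
  by case/andP=> /andP[_ lt_i] _; rewrite leqNgt lt_i mul0r.
rewrite add0r -{1}[lag R s]add0n big_addn.
have -> : ((max_order R).+1 - lag R s = size (nth [::] R s))%N.
  by rewrite lag_s subKn.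
rewrite big_mkord -[RHS](rec_a (q + lag R s)%N).
by apply: eq_bigr => i _; rewrite leq_addl addnK addnA addnAC.
Qed.

Lemma interlaced_lead : exists k0, forall k, (k0 <= k)%N ->
  interlaced_coef R (d * max_order R) k != 0.
Proof.
have ex_k0 (s : 'I_d) := let: And3 _ k0 _ := component_facts s in k0.
have [k0 k0P] := fin_all_exists ex_k0.
(* From d k0 on, the index q in the residue class is at least k0. *)
exists (d * \max_s k0 s)%N => k le_k.
have lt_s := ltn_pmod k d_gt0; set q := (k %/ d)%N; pose s := Ordinal lt_s.
have [size_gt0 _ _] := component_facts s.
rewrite (divn_eq k d) (interlaced_coefE _ _ lt_s) dvdn_mulr // mulKn //=.
have lag_s : lag R s = ((max_order R).+1 - size (nth [::] R s))%N := lagE lt_s.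
have le_size := size_component s.
have -> : (lag R s <= max_order R)%N.
  by rewrite lag_s; move: (size _) size_gt0 le_size => w; lia.
have -> : (max_order R - lag R s = (size (nth [::] R s)).-1)%N.
  by rewrite lag_s; move: (size _) size_gt0 le_size => w; lia.
apply: (k0P s); apply: leq_trans (leq_addr _ _).
by apply: leq_trans (leq_bigmax s) _; rewrite leq_divRL // mulnC.
Qed.

(** For fixed residue s, the coefficient at j is zero or a shift of one of the
    given sequences, so it is annihilated by P. *)
Lemma interlaced_coef_rec j : (j <= d * max_order R)%N ->
  cfinite_rec (d * degree_sum (flatten R)) (fun i => (interlaced_char R)`_i)
              (interlaced_coef R j).
Proof.
have size_P := size_poly_prod codes_valid.
set t := degree_sum _ in size_P *.
have charE i : (i <= d * t)%N -> (interlaced_char R)`_i =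
    if (d %| i)%N then (poly_prod (flatten R))`_(i %/ d) else 0.
  by move=> le_i; rewrite /interlaced_char nth_mkseq size_R ?ltnS.
move=> le_j; split=> [|k].
  rewrite charE // dvdn_mulr // mulKn //.
  have -> : t = (size (poly_prod (flatten R))).-1 by rewrite size_P.
  by rewrite -lead_coefE lead_coef_eq0 -size_poly_gt0 size_P.
under eq_bigr => i _ do rewrite charE -1?ltnS //.
apply: (stretch_annihilates d_gt0 (c := fun s q => interlaced_coef R j (q * d + s))).
- by rewrite size_P.
- move=> s lt_s.
  apply: annihilates_ext (fun q => esym (interlaced_coefE j q lt_s)) _.
  case: (_ && _); last exact: annihilates0.
  apply: (annihilates_shift (c := code_term _)).
  have Rs_i : nth ([::], [::]) (nth [::] R s) (j %/ d - lag R s) \in flatten R.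
    apply/flattenP; exists (nth [::] R s); first by rewrite mem_nth ?size_R.
    have le_size : (size (nth [::] R s) <= (max_order R).+1)%N.
      exact: size_component (Ordinal lt_s).
    have size_gt0 : (0 < size (nth [::] R s))%N.
      by case: (component_facts (Ordinal lt_s)).
    have le_jM : (j %/ d <= max_order R)%N.
      by rewrite -(mulKn (max_order R) d_gt0) leq_div2r.
    apply: mem_nth; rewrite (lagE lt_s).
    by move: (size _) size_gt0 le_size => w; lia.
  have [c z_c] := codes_valid Rs_i.
  exact: poly_prod_annihilates z_c Rs_i.
- by [].
Qed.

End Correctness.

(** * Computability of the recurrence *)

Lemma tracked_code_term A (z : data A -> data cfinite_code) (k : data A -> nat) :
  @computable A cfinite_code z -> @computable A Nat k ->
  trackedK (fun x => code_term (z x) (k x)).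
Proof.
move=> cz ck; apply: tracked_cfinite_term => //; apply: tracked_dec.
  exact: (@comp_fst A (List elt_code) (List elt_code)).
exact: (@comp_snd A (List elt_code) (List elt_code)).
Qed.

Lemma tracked_poly_prod A (X : data A -> data (List cfinite_code)) :
  @computable A (List cfinite_code) X -> trackedP (fun x => poly_prod (X x)).
Proof.
move=> cX; apply: (@tracked_foldr (List elt_code) _ (decode_poly e) A cfinite_code) => //.
  have [u [cu u1]] := trackedK_const basis_e A 1.
  exists (fun x => [:: u x]); split; first by comp.
  by move=> x; rewrite /decode_poly /= u1 cons_poly_def mul0r add0r.
by apply: trackedPM => //; apply: tracked_dec; comp.
Qed.

Lemma comp_degree_sum A (X : data A -> data (List cfinite_code)) :
  @computable A (List cfinite_code) X ->
  @computable A Nat (fun x => degree_sum (X x)).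
Proof.
move=> cX; apply: (@comp_foldr A Nat cfinite_code); comp.
apply comp_add; comp; apply comp_pred; apply (@comp_size _ elt_code); comp.
Qed.

Lemma comp_max_order A (R : data A -> data (List c2_code)) :
  @computable A (List c2_code) R ->
  @computable A Nat (fun x => max_order (R x)).
Proof.
move=> cR; apply: (@comp_foldr A Nat c2_code); comp.
apply comp_max; comp; apply comp_pred; apply (@comp_size _ cfinite_code); comp.
Qed.

Lemma comp_component A (R : data A -> data (List c2_code)) (k : data A -> nat) :
  @computable A (List c2_code) R -> @computable A Nat k ->
  @computable A c2_code (fun x => component (R x) (k x)).
Proof.
move=> cR ck; apply: (@comp_nth A c2_code) => //.
by apply comp_mod => //; apply (@comp_size _ c2_code).
Qed.

Lemma comp_lag A (R : data A -> data (List c2_code)) (k : data A -> nat) :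
  @computable A (List c2_code) R -> @computable A Nat k ->
  @computable A Nat (fun x => lag (R x) (k x)).
Proof.
move=> cR ck; apply comp_sub; first by apply/comp_succ/comp_max_order.
by apply (@comp_size _ cfinite_code); apply: comp_component.
Qed.

Lemma tracked_interlaced_coef A (R : data A -> data (List c2_code))
    (j k : data A -> nat) :
  @computable A (List c2_code) R -> @computable A Nat j -> @computable A Nat k ->
  trackedK (fun x => interlaced_coef (R x) (j x) (k x)).
Proof.
move=> cR cj ck; have c_size := @comp_size A c2_code _ cR.
have c_lag := comp_lag cR ck.
apply: tracked_if; last exact: trackedK_const.
  by apply: test_and; [apply: test_dvd | apply: test_leq => //; apply: comp_div].
apply: tracked_code_term.
  apply: (@comp_nth A cfinite_code); first exact: comp_component.
  by apply: comp_sub => //; apply: comp_div.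
by apply: comp_add => //; apply: comp_div.
Qed.

Lemma tracked_interlaced_char A (R : data A -> data (List c2_code)) :
  @computable A (List c2_code) R -> trackedKs (fun x => interlaced_char (R x)).
Proof.
move=> cR; have c_size := @comp_size A c2_code _ cR.
have c_flat := @comp_flatten A cfinite_code _ cR.
pose D := Pair A Nat.
have c_sizeD : @computable D Nat (fun y => size (R y.1)).
  by apply: (comp_comp c_size); comp.
apply: (tracked_mkseq (f := fun x i => if (size (R x) %| i)%N then
  (poly_prod (flatten (R x)))`_(i %/ size (R x)) else 0)).
  apply: tracked_if; last exact: trackedK_const.
    by apply: test_dvd => //; comp.
  apply: trackedP_coef; last by apply: comp_div => //; comp.
  apply: (tracked_comp (tracked_poly_prod c_flat)); comp.
apply/comp_succ/comp_mul => //; exact: comp_degree_sum.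
Qed.

Lemma interlacing_computable :
  exists F : data (List c2_code) -> data c2_code,
    @computable (List c2_code) c2_code F /\
    forall (d r : nat) (a : 'I_d -> nat -> K) (b : nat -> K)
           (R : data (List c2_code)),
      (1 <= d)%N -> size R = d ->
      (forall s : 'I_d, c2_code_for e r (nth [::] R s) (a s)) ->
      interlacing a b ->
      c2_code_for e (d * r)%N (F R) b.
Proof.
have [G [cG G_char]] := tracked_interlaced_char (computable_id (List c2_code)).
pose D := Pair (List c2_code) Nat.
have tr_coef : trackedK (fun y : data (Pair D Nat) =>
    interlaced_coef y.1.1 y.1.2 y.2).
  by apply: tracked_interlaced_coef; comp.
have c_R : @computable D (List c2_code) fst by comp.
have c_init : @computable D Nat
    (fun y => (size y.1 * degree_sum (flatten y.1))%N).
  apply: comp_mul; first exact: comp_size c_R.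
  exact: (comp_degree_sum (@comp_flatten D cfinite_code _ c_R)).
have [I [cI I_coef]] :=
  tracked_mkseq (f := fun (y : data D) k => interlaced_coef y.1 y.2 k)
                tr_coef c_init.
(* The list G R of coefficients has length one more than the order
   d * degree_sum, and I yields that number of initial values. *)
exists (fun R => mkseq (fun j => (G R, I (R, j)))
                       (size R * max_order R).+1); split.
  have c_id := computable_id (List c2_code).
  apply: (@comp_mkseq (List c2_code) cfinite_code _ (fun R j => (G R, I (R, j)))).
    by comp; [apply: (comp_comp cG) | apply: (comp_comp cI)]; comp.
  apply/comp_succ/comp_mul; [exact: (@comp_size _ c2_code) | exact: comp_max_order].
move=> d r a b R d_gt0 size_R R_a b_a.
set t := (d * degree_sum (flatten R))%N.
have size_G : size (G R) = t.+1.
  by have := G_char R; move/(congr1 size); rewrite size_map size_mkseq size_R.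
have size_I j : size (I (R, j)) = t.
  by have := I_coef (R, j); move/(congr1 size); rewrite size_map size_mkseq size_R.
have code_j (j : 'I_(d * max_order R).+1) :
    cfinite_code_for e (G R, I (R, nat_of_ord j)) (interlaced_coef R j).
  have [|g_t rec_j] := interlaced_coef_rec d_gt0 size_R R_a (j := j).
    by rewrite -ltnS.
  exists t; split=> //=; first split.
  - by rewrite decode_elt_nth G_char.
  - move=> k; rewrite -[RHS](rec_j k); apply: eq_bigr => i _.
    by rewrite decode_elt_nth G_char.
  by move=> k lt_k; rewrite decode_elt_nth I_coef nth_mkseq //= size_R.
exists (d * max_order R)%N, (fun j => interlaced_coef R j); split.
- by rewrite leq_mul2l (max_order_le size_R R_a) orbT.
- by rewrite size_mkseq size_R.
- by move=> j; rewrite nth_mkseq ?size_R.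
split=> [j||k].
- have [t' [_ _ rec_j _]] := code_j j; exists t'.
  by eexists; exact: rec_j.
- exact: interlaced_lead d_gt0 size_R R_a.
exact: interlaced_recurrence d_gt0 size_R R_a b_a k.
Qed.

(** * Codes of arbitrary recurrences *)

Lemma exists_seq (T : Type) (x0 : T) t (P : 'I_t -> T -> Prop) :
  (forall i, exists u, P i u) ->
  exists s : seq T, size s = t /\ forall i : 'I_t, P i (nth x0 s i).
Proof.
case/fin_all_exists=> f f_P; exists [seq f i | i <- enum 'I_t].
split=> [|i]; first by rewrite size_map size_enum_ord.
by rewrite (nth_map i) ?size_enum_ord // nth_ord_enum.
Qed.

Lemma decode_elt_surj (y : K) : exists u, decode_elt e u = y.
Proof.
have [F [_ F_y]] := trackedK_const basis_e Nat y.
by exists (F 0%N); rewrite F_y.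
Qed.

Lemma cfinite_has_code c : cfinite c -> exists z, cfinite_code_for e z c.
Proof.
case=> t [g [g_t rec_c]].
have [l1 [size1 l1E]] :=
  exists_seq ([::] : data elt_code) (fun i : 'I_t.+1 => decode_elt_surj (g i)).
have [l2 [size2 l2E]] :=
  exists_seq ([::] : data elt_code) (fun i : 'I_t => decode_elt_surj (c i)).
exists (l1, l2), t; split=> //=.
  split=> [|k]; first by rewrite (l1E ord_max).
  by rewrite -[RHS](rec_c k); apply: eq_bigr => i _; rewrite l1E.
by move=> i lt_i; rewrite (l2E (Ordinal lt_i)).
Qed.

Lemma c2_finite_has_code r a :
  c2_finite_of_order_le r a -> exists x, c2_code_for e r x a.
Proof.
case=> m [c [le_m rec_a]]; case: (rec_a) => c_fin _ _.
have [x [size_x x_c]] :=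
  exists_seq (([::], [::]) : data cfinite_code)
             (fun i => cfinite_has_code (c_fin i)).
by exists x, m, c.
Qed.

End Algorithm.

Theorem theorem12 (K : fieldExtType rat) :
  (forall (d r : nat) (a : 'I_d -> nat -> K) (b : nat -> K),
     (1 <= d)%N ->
     (forall s : 'I_d, c2_finite_of_order_le r (a s)) ->
     interlacing a b ->
     c2_finite_of_order_le (d * r)%N b)
  /\
  (forall (n : nat) (e : n.-tuple K), basis_of fullv e ->
     exists F : data (List c2_code) -> data c2_code,
       computable F /\
       forall (d r : nat) (a : 'I_d -> nat -> K) (b : nat -> K)
              (R : data (List c2_code)),
         (1 <= d)%N ->
         size R = d ->
         (forall s : 'I_d, c2_code_for e r (nth [::] R s) (a s)) ->
         interlacing a b ->
         c2_code_for e (d * r)%N (F R) b).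
Proof.
split=> [d r a b d_gt0 a_fin b_a | n e]; last exact: interlacing_computable.
have basis_e := vbasisP (fullv : {vspace K}).
have [F [_ F_ok]] := interlacing_computable basis_e.
have [R [size_R R_a]] :=
  exists_seq ([::] : data c2_code)
             (fun s => c2_finite_has_code basis_e (a_fin s)).
have [m [c [le_m _ _ rec_b]]] := F_ok d r a b R d_gt0 size_R R_a b_a.
by exists m, c.
Qed.
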